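(* Let $f\colon\mathbb{R}^n\to[-\infty,+\infty]$ be an absolutely symmetric function and let $X\in\mathbb{M}_{m,n}$ with $(f\circ\sigma)(X)$ finite. Suppose $f$ satisfies one of the following conditions: (a) $f$ is lower semicontinuous and convex with $\partial f(\sigma(X))\neq\emptyset$; (b) $f$ is locally Lipschitz continuous around $\sigma(X)$ relative to its domain. Then for all $H\in\mathbb{M}_{m,n}$, $$\mathrm{d}(f\circ\sigma)(X)(H)=\mathrm{d}f(\sigma(X))\big(\sigma'(X;H)\big).$$
   Context: Throughout, $m,n$ are natural numbers with $n\le m$; $\mathbb{M}_{m,n}$ is the space of real $m\times n$ matrices with inner product $\langle X,Y\rangle=\mathrm{tr}(X^TY)$ and Frobenius norm; $\sigma(X)=(\sigma_1(X),\dots,\sigma_n(X))$ is the vector of singular values of $X$ in nonincreasing order. $\sigma'(X;H)=\lim_{t\downarrow0}(\sigma(X+tH)-\sigma(X))/t$ (it always exists). A function $f\colon\mathbb{R}^n\to[-\infty,+\infty]$ is absolutely symmetric if $f(Qx)=f(x)$ for all $x$ and all $n\times n$ signed permutation matrices $Q$ (entries in $\{0,\pm1\}$, exactly one nonzero entry in each row and column). $\mathrm{dom}\,f=\{x: f(x)<\infty\}$. $f$ is locally Lipschitz continuous around $\bar x$ relative to $C\subset\mathrm{dom}\,f$ if $\bar x\in C$, $f(\bar x)$ is finite, and there are $l\ge0$ and a neighborhood $O$ of $\bar x$ with $|f(x)-f(y)|\le l\|x-y\|$ for all $x,y\in O\cap C$. For an extended-real-valued function $g$ on a Euclidean space with $g(\bar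 x)$ finite, the subderivative is $\mathrm{d}g(\bar x)(w)=\liminf_{t\downarrow0,\,w'\to w}\frac{g(\bar x+tw')-g(\bar x)}{t}$. $\partial f$ is the subdifferential of convex analysis. *)

(* Defs.v *)
From HB Require Import structures.
From mathcomp Require Import all_boot all_order all_algebra.
From mathcomp Require Import polyrcf.
From mathcomp Require Import all_classical all_reals all_analysis.
Set Implicit Arguments.
Unset Strict Implicit.
Unset Printing Implicit Defensive.
Import Order.TTheory GRing.Theory Num.Theory.
Import numFieldNormedType.Exports.
Local Open Scope classical_set_scope.
Local Open Scope ring_scope.

Section Euclidean.
Variables (R : realType) (m n : nat).
Implicit Types X Y : 'M[R]_(m, n).

(* For n = 1 these are the dot product and the Euclidean norm; the norm of the
   normedModType 'M[R]_(m, n) is the max norm, with the same topology. *)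
Definition mxdot X Y : R := \tr (X^T *m Y).
Definition frobenius X : R := Num.sqrt (mxdot X X).

End Euclidean.

Section SingularValues.
Variable R : realType.

(* the real eigenvalues of A, repeated according to their multiplicity in the
   characteristic polynomial, in nonincreasing order; for a symmetric A the
   characteristic polynomial splits, so there are n of them and the default
   value of nth in sigma is not used *)
Definition eigenvalues n (A : 'M[R]_n) : seq R :=
  sort >=%R (flatten [seq nseq (mup x (char_poly A)) x
                     | x <- rootsR (char_poly A)]).

Definition sigma m n (X : 'M[R]_(m, n)) : 'cV[R]_n :=
  \col_(i < n) Num.sqrt (nth 0 (eigenvalues (X^T *m X)) i).

Definition sigma' m n (X H : 'M[R]_(m, n)) : 'cV[R]_n :=
  lim ((t^-1 *: (sigma (X + t *: H) - sigma X)) @[t --> 0^'+]).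

End SingularValues.

Section VectorFunctions.
Variables (R : realType) (n : nat).
Implicit Types (f : 'cV[R]_n -> \bar R) (x : 'cV[R]_n).

Definition signed_permutation (Q : 'M[R]_n) : Prop :=
  [/\ forall i j, Q i j \in [:: 0; 1; -1],
      forall i, exists! j, Q i j != 0
    & forall j, exists! i, Q i j != 0].

Definition absolutely_symmetric f : Prop :=
  forall Q, signed_permutation Q -> forall x, f (Q *m x) = f x.

Definition edom f : set 'cV[R]_n := [set x | (f x < +oo)%E].

Definition convex_efun f : Prop :=
  @convex_set R ('cV[R]_n * R^o)%type [set p | (f p.1 <= p.2%:E)%E].

Definition subdifferential f x : set 'cV[R]_n :=
  [set v | f x \is a fin_num /\
           forall y, (f x + (mxdot v (y - x))%:E <= f y)%E].

(* -oo - -oo = -oo here, with absolute value +oo, so the bound makes f finite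
   on O `&` C *)
Definition locally_lipschitz_rel f x (C : set 'cV[R]_n) : Prop :=
  [/\ C `<=` edom f, C x, f x \is a fin_num &
      exists2 l : R, 0 <= l & exists2 O, nbhs x O &
        forall y z, (O `&` C) y -> (O `&` C) z ->
          (`|f y - f z| <= (l * frobenius (y - z))%:E)%E].

End VectorFunctions.

Definition subderivative (R : realType) (V : normedModType R)
    (g : V -> \bar R) (x w : V) : \bar R :=
  limf_einf (fun p : R * V => ((g (x + p.1 *: p.2)%R - g x) * p.1^-1%:E)%E)
    (filter_prod 0^'+ (nbhs w)).

(* Main.v *)
Require Import Defs.
From mathcomp Require Import all_boot all_order all_algebra.
From mathcomp Require Import all_classical all_reals all_analysis.
From mathcomp Require Import all_fingroup polyrcf complex.
From mathcomp Require Import ring lra.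
Import Order.TTheory GRing.Theory Num.Theory.
Import numFieldNormedType.Exports.
Local Open Scope classical_set_scope.
Local Open Scope ring_scope.
Set Implicit Arguments.
Unset Strict Implicit.
Unset Printing Implicit Defensive.

(** Write [q t H' = (sigma (X + t H') - sigma X) / t], so that
    [sigma X + t * q t H' = sigma (X + t H')].

    Two facts about singular values carry the proof. The first is that [sigma]
    is Lipschitz and has directional derivatives, so that [q t H'] tends to
    [sigma' X H] as [t] decreases to 0 and [H'] tends to [H]. Both properties
    come from the Ky Fan sums [sigma_1 + ... + sigma_k], each of which is a
    maximum of linear functionals with uniformly bounded coefficients
    ([kyfan_support]): such a function is Lipschitz, and being convex it has
    one-sided derivatives along lines. The singular values are differences of
    consecutive Ky Fan sums. The second fact is that [X + t H = U diag(s) V^T]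
    with [s = sigma (X + t H)] can be rebuilt with any vector [y] in place of
    [s]: the singular values of [U diag(y) V^T] are the [|y_i|] in sorted
    order, that is [Q y] for a signed permutation matrix [Q]
    ([sigma_svd_signed_perm]).

    The substitution [H' |-> q t H'] turns every difference quotient of
    [f \o sigma] near [H] into a difference quotient of [f] near [sigma' X H]
    with the same value, which gives one inequality between the lower limits.
    Conversely, for [z] near [sigma' X H], put [y = sigma X + t z] in the
    decomposition of [X + t H] and write the result as [X + t H']. Then
    [f (sigma (X + t H')) = f (Q y) = f (sigma X + t z)] by absolute symmetry,
    and [H' - H = U diag(z - q t H) V^T] is small because [z] and [q t H] are
    both close to [sigma' X H] ([sigma_lift]). This gives the other
    inequality. *)

(** * The singular value decomposition *)

Section SingularValueDecomposition.
Variable R : rcfType.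

Definition orthonormal m n (U : 'M[R]_(m, n)) : Prop := U^T *m U = 1%:M.

Definition svd_mx m n (U : 'M[R]_(m, n)) (y : 'cV[R]_n) (V : 'M[R]_n) :
    'M[R]_(m, n) :=
  U *m diag_mx y^T *m V^T.

Lemma orthonormalM m n p (U : 'M[R]_(m, n)) (V : 'M[R]_(n, p)) :
  orthonormal U -> orthonormal V -> orthonormal (U *m V).
Proof.
by rewrite /orthonormal trmx_mul mulmxA -(mulmxA V^T) => -> ; rewrite mulmx1.
Qed.

Lemma orthonormal_tr n (Q : 'M[R]_n) : orthonormal Q -> orthonormal Q^T.
Proof. by rewrite /orthonormal trmxK => /mulmx1C. Qed.

Lemma gram_diag m n (X : 'M[R]_(m, n)) j :
  (X^T *m X) j j = \sum_i X i j ^+ 2.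
Proof. by rewrite !mxE; apply: eq_bigr => i _; rewrite mxE. Qed.

Lemma gram_ge0 m n (X : 'M[R]_(m, n)) j : 0 <= (X^T *m X) j j.
Proof. by rewrite gram_diag sumr_ge0 // => i _; rewrite sqr_ge0. Qed.

Lemma gram_eq0 m n (X : 'M[R]_(m, n)) : X^T *m X = 0 -> X = 0.
Proof.
move=> X0; apply/matrixP => i j; rewrite mxE; apply/eqP.
have := gram_diag X j; rewrite X0 mxE => /esym/eqP.
rewrite psumr_eq0 => [/allP/(_ i)|? _]; last exact: sqr_ge0.
by rewrite mem_index_enum sqrf_eq0; apply.
Qed.

Lemma orthonormal_entry_le1 m n (U : 'M[R]_(m, n)) i j :
  orthonormal U -> `|U i j| <= 1.
Proof.
move=> oU; rewrite -(ler_pXn2r (n := 2)) ?nnegrE ?ler01 ?normr_ge0 //.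
rewrite expr1n real_normK ?num_real //.
have <- : (U^T *m U) j j = 1 by rewrite oU mxE eqxx.
by rewrite gram_diag (bigD1 i) //= lerDl sumr_ge0 // => k _; rewrite sqr_ge0.
Qed.

(** The witness is the Householder reflection in the hyperplane orthogonal to
    [v - e_0], which exchanges the unit vectors [v] and [e_0]. *)
Lemma householder n (v : 'cV[R]_(1 + n)) : orthonormal v ->
  exists2 Q : 'M[R]_(1 + n), orthonormal Q & Q *m v = delta_mx 0 0.
Proof.
move=> v1; pose e : 'cV[R]_(1 + n) := delta_mx 0 0; pose w := v - e.
have [w0|wN0] := eqVneq w 0.
  exists 1%:M; first by rewrite /orthonormal trmx1 mulmx1.
  by rewrite mul1mx; apply/eqP; rewrite -subr_eq0; apply/eqP.
pose c := (w^T *m w) 0 0.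
have wc : w^T *m w = c%:M by rewrite [LHS]mx11_scalar.
have cN0 : c != 0.
  by apply: contraNneq wN0 => c0; apply/eqP/gram_eq0; rewrite wc c0 raddf0.
have ev : e^T *m v = (v 0 0)%:M.
  rewrite [LHS]mx11_scalar /e trmx_delta -rowE; congr (_ %:M).
  by rewrite !mxE.
have ve : v^T *m e = (v 0 0)%:M.
  by rewrite -[LHS]trmxK trmx_mul trmxK ev tr_scalar_mx.
have ee : e^T *m e = 1%:M.
  by rewrite /e trmx_delta mul_delta_mx [LHS]mx11_scalar mxE !eqxx.
have wT : w^T = v^T - e^T by rewrite /w linearB.
have wv : w^T *m v = (c / 2)%:M.
  have -> : c = 2 - 2 * v 0 0.
    rewrite /c wT /w mulmxBr !mulmxBl v1 ve ev ee !mxE eqxx !mulr1n; ring.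
  by rewrite wT mulmxBl v1 ev -raddfB /=; congr (_ %:M); field.
exists (1%:M - (2 / c) *: (w *m w^T)); rewrite /orthonormal; last first.
  rewrite mulmxBl mul1mx -scalemxAl -mulmxA wv mul_mx_scalar scalerA.
  have -> : 2 / c * (c / 2) = 1 by field.
  by rewrite scale1r /w opprB addrC subrK.
have -> : (1%:M - (2 / c) *: (w *m w^T))^T = 1%:M - (2 / c) *: (w *m w^T).
  by rewrite [LHS]linearB /= trmx1 [X in _ - X]linearZ /= trmx_mul trmxK.
rewrite mulmxBl mul1mx mulmxBr mulmx1 -scalemxAl -scalemxAr scalerA.
rewrite mulmxA -(mulmxA w) wc mul_mx_scalar -scalemxAl scalerA.
rewrite -addrA -opprD -[RHS]subr0; congr (_ - _).
apply/eqP; rewrite addrA subr_eq0 -scalerDl; apply/eqP.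
by congr (_ *: _); field.
Qed.

(** The spectral theorem over [R[i]] diagonalizes [X^T X] with real
    eigenvalues; they are not all zero since [X^T X] is not, and a real root of
    the characteristic polynomial has an eigenvector with real entries. *)
Lemma gram_eigenvector m n (X : 'M[R]_(m, n)) : X != 0 ->
  exists s (v : 'cV[R]_n),
    [/\ 0 < s, orthonormal v & X^T *m (X *m v) = s ^+ 2 *: v].
Proof.
move=> XN0; pose A := X^T *m X.
pose toC : {rmorphism R -> R[i]} := real_complex R.
have tA : A^T = A by rewrite trmx_mul trmxK.
pose AC := map_mx toC A.
have realC a : toC a \is Num.real by rewrite realE !lecR -realE num_real.
have herm : AC \is hermsymmx.
  apply: realsym_hermsym; last by apply/mxOverP => i j; rewrite mxE.
  by apply/is_hermitianmxP; rewrite expr0 scale1r map_mx_id // map_trmx tA.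
pose d := spectral_diag AC; pose P := spectralmx AC.
have specA : AC = invmx P *m diag_mx d *m P.
  exact/orthomx_spectralP/hermitian_normalmx.
have [i dN0] : exists i, d 0 i != 0.
  apply/existsP; apply: contraNT XN0; rewrite negb_exists => /forallP d0.
  apply/eqP/gram_eq0/(map_mx_inj (f := toC)).
  rewrite -[LHS]/AC specA map_mx0 (_ : d = 0) ?linear0 ?mulmx0 ?mul0mx //.
  by apply/rowP => j; have := d0 j; rewrite negbK mxE => /eqP.
have [a da] : exists a, d 0 i = toC a.
  have := mxOverP (hermitian_spectral_diag_real herm) 0 i.
  by rewrite -/d => /RRe_real <-; exists (complex.Re (d 0 i)).
have aN0 : a != 0 by apply: contraNneq dN0 => a0; rewrite da a0 rmorph0.
have : eigenvalue A a.
  rewrite eigenvalue_root_char -(fmorph_root toC) map_char_poly -/AC -da.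
  rewrite -eigenvalue_root_char; apply/eigenvalueP; exists (row i P).
    rewrite {1}specA -row_mul !mulmxA mulmxV ?spectral_unit // mul1mx.
    by rewrite mul_diag_mx; apply/rowP => j; rewrite !mxE.
  apply: contraTneq (spectral_unit AC) => Pi0; rewrite -row_full_unit.
  apply/negP => /row_fullP[Q QP]; have := mulmx1C QP.
  move/(congr1 (row i)); rewrite row_mul Pi0 mul0mx => /rowP/(_ i).
  by rewrite !mxE eqxx => /esym/eqP; rewrite oner_eq0.
case/eigenvalueP => u uA uN0.
pose c := (u *m u^T) 0 0.
have uc : u *m u^T = c%:M by rewrite [LHS]mx11_scalar.
have c_ge0 : 0 <= c by have := gram_ge0 u^T 0; rewrite trmxK.
have cN0 : c != 0.
  apply: contraNneq uN0 => c0; rewrite -trmx_eq0; apply/eqP/gram_eq0.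
  by rewrite trmxK uc c0 raddf0.
have c_gt0 : 0 < c by rewrite lt_neqAle eq_sym cN0.
have a_gt0 : 0 < a.
  rewrite lt_neqAle eq_sym aN0 -(pmulr_lge0 _ c_gt0) /=.
  have -> : a * c = ((X *m u^T)^T *m (X *m u^T)) 0 0.
    rewrite trmx_mul trmxK -mulmxA (mulmxA X^T) mulmxA -/A uA -scalemxAl uc.
    by rewrite !mxE eqxx mulr1n.
  exact: gram_ge0.
exists (Num.sqrt a), ((Num.sqrt c)^-1 *: u^T); split.
- by rewrite sqrtr_gt0.
- rewrite /orthonormal [X in X *m _]linearZ /= trmxK -scalemxAl -scalemxAr uc.
  by rewrite scalerA -invfM -expr2 sqr_sqrtr // scale_scalar_mx mulVf.
- rewrite sqr_sqrtr 1?ltW // mulmxA -/A -scalemxAr scalerA mulrC -scalerA.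
  by congr (_ *: _); rewrite -tA -trmx_mul uA linearZ.
Qed.

Lemma orthonormal_block m n (U : 'M[R]_(m, n)) : orthonormal U ->
  orthonormal (block_mx 1%:M 0 0 U : 'M[R]_(1 + m, 1 + n)).
Proof.
move=> oU; rewrite /orthonormal tr_block_mx mulmx_block !trmx0 trmx1.
by rewrite !mulmx0 !mul0mx !addr0 add0r mulmx1 oU -scalar_mx_block.
Qed.

Lemma svd_mx_block m n s (U : 'M[R]_(m, n)) y V :
  block_mx s%:M 0 0 (svd_mx U y V) =
  svd_mx (block_mx 1%:M 0 0 U) (col_mx s%:M y : 'cV[R]_(1 + n))
         (block_mx 1%:M 0 0 V).
Proof.
rewrite /svd_mx tr_col_mx diag_mx_row tr_scalar_mx tr_block_mx !mulmx_block.
rewrite !trmx0 trmx1 ?(mulmx0, mul0mx, addr0, add0r, mulmx1, mul1mx).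
by congr block_mx; apply/matrixP => i j; rewrite !mxE !ord1 !eqxx mulr1n.
Qed.

Lemma svd_mxM m n p (P : 'M[R]_(p, m)) (U : 'M[R]_(m, n)) y (V Q : 'M[R]_n) :
  P *m svd_mx U y V *m Q^T = svd_mx (P *m U) y (Q *m V).
Proof. by rewrite /svd_mx trmx_mul !mulmxA. Qed.

Lemma svd_mxD m n (U : 'M[R]_(m, n)) y z V :
  svd_mx U (y + z) V = svd_mx U y V + svd_mx U z V.
Proof.
by rewrite /svd_mx -mulmxDl -mulmxDr; congr (_ *m _ *m _); rewrite !linearD.
Qed.

Lemma svd_mxZ m n (U : 'M[R]_(m, n)) a y V :
  svd_mx U (a *: y) V = a *: svd_mx U y V.
Proof.
by rewrite /svd_mx scalemxAl scalemxAr; congr (_ *m _ *m _); rewrite !linearZ.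
Qed.

(** Deflation: unit vectors [u], [v] with [X v = s u] and [X^T u = s v] are
    rotated to the first basis vectors, after which [X] is block diagonal with
    blocks [s] and a smaller matrix. *)
Lemma svd_exists m n (X : 'M[R]_(m, n)) : (n <= m)%N ->
  exists U y V, [/\ orthonormal U, orthonormal V & X = svd_mx U y V].
Proof.
elim: n m X => [|n IHn] m X le_nm.
  by exists 0, 0, 0; split;
    rewrite /orthonormal ?[LHS]flatmx0 ?[RHS]flatmx0 ?[LHS]thinmx0 ?[RHS]thinmx0.
case: m X le_nm => // m X le_nm.
have [->|XN0] := eqVneq X 0.
  exists (pid_mx n.+1), 0, 1%:M; split.
  - rewrite /orthonormal tr_pid_mx mul_pid_mx minnn (minn_idPr le_nm).
    exact: pid_mx_1.
  - by rewrite /orthonormal trmx1 mulmx1.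
  - by rewrite /svd_mx trmx0 linear0 mulmx0 mul0mx.
have [s [v [s_gt0 v1 XXv]]] := gram_eigenvector XN0.
have sN0 : s != 0 by rewrite gt_eqF.
pose u := s^-1 *: (X *m v).
have u1 : orthonormal u.
  rewrite /orthonormal [X in X *m _]linearZ /= -scalemxAl -scalemxAr scalerA.
  rewrite trmx_mul -mulmxA XXv -scalemxAr scalerA v1 -invfM -expr2.
  by rewrite mulVf ?expf_neq0 ?scale1r.
have Xv : X *m v = s *: u by rewrite scalerA divff // scale1r.
have Xu : X^T *m u = s *: v.
  by rewrite -scalemxAr XXv scalerA expr2 mulrA mulVf // mul1r.
have [P oP Pu] := @householder m u u1; have [Q oQ Qv] := @householder n v v1.
pose M : 'M[R]_(1 + m, 1 + n) := P *m X *m Q^T.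
have PM : X = P^T *m M *m Q by rewrite /M !mulmxA oP mul1mx -mulmxA oQ mulmx1.
have PTe : P^T *m delta_mx 0 0 = u by rewrite -Pu mulmxA oP mul1mx.
have QTe : Q^T *m delta_mx 0 0 = v by rewrite -Qv mulmxA oQ mul1mx.
have Me : M *m delta_mx 0 0 = s *: delta_mx 0 0 :> 'cV[R]_(1 + m).
  by rewrite /M -mulmxA QTe -mulmxA Xv -scalemxAr Pu.
have MTe : M^T *m delta_mx 0 0 = s *: delta_mx 0 0 :> 'cV[R]_(1 + n).
  by rewrite /M !trmx_mul trmxK -!mulmxA PTe Xu -scalemxAr Qv.
have e0 p :
    delta_mx 0 0 = delta_mx (lshift p (0 : 'I_1)) 0 :> 'cV[R]_(1 + p).
  by congr delta_mx; apply: val_inj.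
have Mcol i : M i (lshift n 0) = s * (i == lshift m 0)%:R.
  by move: Me; rewrite !e0 -colE => /colP/(_ i); rewrite !mxE eqxx andbT.
have Mrow j : M (lshift m 0) j = s * (j == lshift n 0)%:R.
  by move: MTe; rewrite !e0 -colE => /colP/(_ j); rewrite !mxE eqxx andbT.
have [U [y [V [oU oV X']]]] := IHn m (drsubmx M : 'M[R]_(m, n)) le_nm.
have MB : M = block_mx s%:M 0 0 (drsubmx M).
  rewrite -[LHS]submxK; congr block_mx; apply/matrixP => i j;
    move: Mcol Mrow; move: (M) => N Ncol Nrow.
  - by rewrite !mxE !ord1 Ncol eqxx mulr1 mulr1n.
  - by rewrite !mxE !ord1 Nrow mulr0.
  - by rewrite !mxE !ord1 Ncol mulr0.
exists (P^T *m (block_mx 1%:M 0 0 U : 'M[R]_(1 + m, 1 + n))).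
exists (col_mx s%:M y : 'cV[R]_(1 + n)).
exists (Q^T *m (block_mx 1%:M 0 0 V : 'M[R]_(1 + n))); split.
- by apply: orthonormalM (orthonormal_block oU); apply: orthonormal_tr.
- by apply: orthonormalM (orthonormal_block oV); apply: orthonormal_tr.
by rewrite PM MB X' svd_mx_block -[Q in LHS]trmxK svd_mxM.
Qed.

End SingularValueDecomposition.

(** * Singular values of a decomposed matrix *)

Section SingularValues.
Variable R : realType.

Lemma mup_prod_XsubC (s : seq R) z :
  mup z (\prod_(x <- s) ('X - x%:P)) = count_mem z s.
Proof.
elim: s => [|x s IHs]; first by rewrite big_nil mupNroot // root1.
rewrite big_cons mupM ?polyXsubC_eq0 ?monic_neq0 ?monic_prod_XsubC // IHs /=.
by rewrite -['X - _]expr1 mup_XsubCX; case: eqP.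
Qed.

Lemma perm_rootsR (s : seq R) (p := \prod_(x <- s) ('X - x%:P)) :
  perm_eq (flatten [seq nseq (mup x p) x | x <- rootsR p]) s.
Proof.
have pN0 : p != 0 by rewrite monic_neq0 ?monic_prod_XsubC.
have in_roots z : (z \in rootsR p) = (z \in s).
  by rewrite -roots_on_rootsR // in_itv /= root_prod_XsubC.
apply/allP => z _; rewrite /= count_flatten -map_comp sumnE big_map.
rewrite (eq_bigr (fun x => if x == z then count_mem z s else 0)%N); last first.
  move=> x _; rewrite /= count_nseq /= mup_prod_XsubC.
  by case: eqP => [->|]; rewrite ?mul1n.
rewrite -big_mkcond /= big_const_seq iter_addn_0.
have [zs|zNs] := boolP (z \in s); last by rewrite (count_memPn zNs) mul0n.
by rewrite (count_uniq_mem _ (uniq_roots _ _ _)) in_roots zs muln1.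
Qed.

Lemma char_poly_orthonormal n (V : 'M[R]_n) (d : 'rV[R]_n) : orthonormal V ->
  char_poly (V *m diag_mx d *m V^T) = \prod_(i < n) ('X - (d 0 i)%:P).
Proof.
move=> oV; have VVT : V *m V^T = 1%:M by apply: mulmx1C.
pose C (A : 'M[R]_n) := map_mx polyC A.
have -> : char_poly (V *m diag_mx d *m V^T) = char_poly (diag_mx d).
  have CM A B : C (A *m B) = C A *m C B := map_mxM _ A B.
  rewrite /char_poly
    (_ : char_poly_mx _ = C V *m char_poly_mx (diag_mx d) *m C V^T).
    by rewrite !det_mulmx mulrAC -det_mulmx -CM VVT /C map_mx1 det1 mul1r.
  rewrite /char_poly_mx -!/(C _) !CM mulmxBr mulmxBl; congr (_ - _).
  by rewrite mul_mx_scalar -scalemxAl -CM VVT /C map_mx1 scalemx1.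
rewrite char_poly_trig; last exact/diag_mx_is_trig.
by apply: eq_bigr => i _; rewrite mxE eqxx mulr1n.
Qed.

Lemma perm_eigenvalues n (V : 'M[R]_n) (d : 'rV[R]_n) : orthonormal V ->
  perm_eq (eigenvalues (V *m diag_mx d *m V^T)) (codom (d 0)).
Proof.
move=> oV; rewrite /eigenvalues perm_sort char_poly_orthonormal //.
rewrite (_ : \prod_(i < n) _ = \prod_(x <- codom (d 0)) ('X - x%:P)).
  exact: perm_rootsR.
by rewrite big_image.
Qed.

Lemma gram_svd m n (U : 'M[R]_(m, n)) y V : orthonormal U ->
  (svd_mx U y V)^T *m svd_mx U y V = V *m diag_mx (\row_i y i 0 ^+ 2) *m V^T.
Proof.
move=> oU; rewrite /svd_mx !trmx_mul trmxK tr_diag_mx !mulmxA -(mulmxA _ U^T) oU.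
rewrite mulmx1 -(mulmxA V _ (diag_mx _)) mulmx_diag; congr (_ *m diag_mx _ *m _).
by apply/rowP => i; rewrite !mxE expr2.
Qed.

Lemma sigma_svd m n (U : 'M[R]_(m, n)) y V : orthonormal U -> orthonormal V ->
  exists s : 'S_n, forall i, sigma (svd_mx U y V) i 0 = `|y (s i) 0|.
Proof.
move=> oU oV; pose t := [tuple y i 0 ^+ 2 | i < n].
have : perm_eq (eigenvalues ((svd_mx U y V)^T *m svd_mx U y V)) t.
  rewrite gram_svd // (perm_trans (perm_eigenvalues _ oV)) //.
  by rewrite (_ : codom _ = t) //; apply: eq_map => i; rewrite mxE.
case/tuple_permP => s eig; exists s => i.
by rewrite mxE eig nth_mktuple tnth_mktuple sqrtr_sqr.
Qed.

Lemma sigma_ge0 m n (X : 'M[R]_(m, n)) i : 0 <= sigma X i 0.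
Proof. by rewrite mxE sqrtr_ge0. Qed.

Lemma sigma_sorted m n (X : 'M[R]_(m, n)) (i j : 'I_n) : (n <= m)%N ->
  (i <= j)%N -> sigma X j 0 <= sigma X i 0.
Proof.
move=> le_nm le_ij; have [U [y [V [oU oV XE]]]] := svd_exists X le_nm.
have size_eig : size (eigenvalues (X^T *m X)) = n.
  rewrite XE gram_svd // (perm_size (perm_eigenvalues _ oV)) size_codom.
  exact: card_ord.
rewrite !mxE ler_wsqrtr //.
apply: (sorted_leq_nth (leT := >=%R)) => //; rewrite ?inE ?size_eig ?ltn_ord //.
- exact: ge_trans.
- exact: lexx.
- exact/sort_sorted/ge_total.
Qed.

Definition signed_perm_mx n (s : 'S_n) (e : 'rV[R]_n) : 'M[R]_n :=
  perm_mx s *m diag_mx e.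

Lemma signed_perm_mxP n (s : 'S_n) (y : 'cV[R]_n)
    (e := \row_j (if y j 0 < 0 then -1 else 1)) :
  [/\ signed_permutation (signed_perm_mx s e),
      orthonormal (signed_perm_mx s e)
    & forall i, (signed_perm_mx s e *m y) i 0 = `|y (s i) 0|].
Proof.
have QE i j : signed_perm_mx s e i j = if s i == j then e 0 j else 0.
  by rewrite /signed_perm_mx mul_mx_diag !mxE; case: eqP;
    rewrite ?mul0r ?mul1r.
have eN0 j : e 0 j != 0 by rewrite mxE; case: ifP; rewrite ?oppr_eq0 oner_eq0.
have QN0 i j : (signed_perm_mx s e i j != 0) = (s i == j).
  by rewrite QE; case: ifP; rewrite ?eN0 ?eqxx.
split.
- split=> [i j|i|j].
  + by rewrite QE mxE !inE; do ![case: ifP]; rewrite ?eqxx ?orbT.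
  + by exists (s i); split=> [|j]; rewrite QN0 // => /eqP.
  + exists ((s^-1)%g j); split=> [|i]; rewrite QN0 ?permKV // => /eqP <-.
    by rewrite permK.
- rewrite /orthonormal /signed_perm_mx trmx_mul tr_diag_mx -mulmxA (mulmxA _^T).
  rewrite tr_perm_mx -perm_mxM mulVg perm_mx1 mul1mx mulmx_diag.
  by apply/matrixP => i j; rewrite !mxE; congr (_ *+ _); case: ifP => _; ring.
- move=> i; rewrite mxE (bigD1 (s i)) //= big1 => [|j /negPf]; last first.
    by rewrite QE eq_sym => ->; rewrite mul0r.
  rewrite QE eqxx mxE addr0; case: ltrP => y0; first by rewrite ltr0_norm ?mulN1r.
  by rewrite mul1r ger0_norm.
Qed.

Lemma diag_signed_perm n (s : 'S_n) e (y : 'cV[R]_n) (Q := signed_perm_mx s e) :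
  orthonormal Q -> Q^T *m diag_mx (Q *m y)^T *m perm_mx s = diag_mx y^T.
Proof.
have comm (z : 'cV[R]_n) :
    diag_mx (perm_mx s *m z)^T *m perm_mx s = perm_mx s *m diag_mx z^T.
  rewrite mul_mx_diag mul_diag_mx -row_permE; apply/matrixP => i j; rewrite !mxE.
  by case: eqP => [->|]; rewrite ?mulr0 ?mul0r // mulrC.
rewrite /Q /orthonormal => oQ; rewrite -mulmxA -[X in diag_mx X^T]mulmxA comm.
have -> : diag_mx (diag_mx e *m y)^T = diag_mx e *m diag_mx y^T.
  rewrite mulmx_diag; congr diag_mx; apply/rowP => i.
  by rewrite mxE mul_diag_mx !mxE.
by rewrite (mulmxA (perm_mx s)) mulmxA oQ mul1mx.
Qed.

Lemma sigma_svd_signed_perm m n (U : 'M[R]_(m, n)) y V :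
    orthonormal U -> orthonormal V ->
  exists s e, [/\ signed_permutation (signed_perm_mx s e),
    orthonormal (signed_perm_mx s e)
    & sigma (svd_mx U y V) = signed_perm_mx s e *m y].
Proof.
move=> oU oV; have [s sE] := sigma_svd y oU oV.
have [Q1 Q2 Q3] := signed_perm_mxP s y.
exists s; eexists; split; [exact: Q1|exact: Q2|].
by apply/colP => i; rewrite Q3 sE.
Qed.

(** The signs and the order of an arbitrary diagonal factor are absorbed into
    the orthonormal factors. *)
Lemma svd_sigma m n (X : 'M[R]_(m, n)) : (n <= m)%N ->
  exists U V, [/\ orthonormal U, orthonormal V & X = svd_mx U (sigma X) V].
Proof.
move=> le_nm; have [U [y [V [oU oV XE]]]] := svd_exists X le_nm.
have [s [e [_ oQ sX]]] := sigma_svd_signed_perm y oU oV; rewrite -XE in sX.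
have oP : orthonormal ((perm_mx s)^T : 'M[R]_n).
  by rewrite /orthonormal trmxK tr_perm_mx -perm_mxM mulgV perm_mx1.
exists (U *m (signed_perm_mx s e)^T), (V *m (perm_mx s)^T); split.
- by apply: orthonormalM => //; apply: orthonormal_tr.
- exact: orthonormalM.
rewrite [LHS]XE sX /svd_mx [(V *m _)^T]trmx_mul trmxK -(diag_signed_perm y oQ).
by rewrite !mulmxA.
Qed.

End SingularValues.

(** * Ky Fan sums as maxima of linear functionals *)

Section KyFan.
Variable R : realType.

Definition kyfan n k (x : 'cV[R]_n) : R := \sum_(i < n | (i < k)%N) x i 0.

Definition kyfan_vec n k : 'cV[R]_n := \col_i (i < k)%:R.

(** The difference of the two sides is the squared norm of the component of the
    [j]-th column of [U] orthogonal to the columns of [P]. *)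
Lemma bessel m n p (P : 'M[R]_(m, p)) (U : 'M[R]_(m, n)) j :
  orthonormal P -> orthonormal U -> \sum_i (P^T *m U) i j ^+ 2 <= 1.
Proof.
move=> oP oU; rewrite -gram_diag -subr_ge0.
have -> : 1 - ((P^T *m U)^T *m (P^T *m U)) j j =
    ((U - P *m (P^T *m U))^T *m (U - P *m (P^T *m U))) j j; last exact: gram_ge0.
have -> : (U - P *m (P^T *m U))^T = U^T - (P^T *m U)^T *m P^T.
  by rewrite linearB /= [(P *m _)^T]trmx_mul.
rewrite mulmxBl !mulmxBr oU -!mulmxA (mulmxA P^T P) oP mul1mx subrr subr0.
by rewrite trmx_mul trmxK -mulmxA !mxE eqxx.
Qed.

Lemma bessel_row m n p (P : 'M[R]_(m, p)) (U : 'M[R]_(m, n)) i :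
  orthonormal P -> orthonormal U -> \sum_j (P^T *m U) i j ^+ 2 <= 1.
Proof.
move=> oP oU; rewrite -[P^T *m U]trmxK trmx_mul trmxK.
by under eq_bigr do rewrite [_^T _ _]mxE; apply: bessel.
Qed.

Lemma mxdot_svd m n (P U : 'M[R]_(m, n)) a b (Q V : 'M[R]_n) :
  mxdot (svd_mx P a Q) (svd_mx U b V) =
  \sum_i \sum_j a i 0 * b j 0 * ((P^T *m U) i j * (Q^T *m V) i j).
Proof.
have -> : mxdot (svd_mx P a Q) (svd_mx U b V) =
    \tr (diag_mx a^T *m (P^T *m U) *m diag_mx b^T *m (Q^T *m V)^T).
  rewrite /mxdot /svd_mx 2!trmx_mul trmxK tr_diag_mx -!mulmxA mxtrace_mulC.
  by rewrite trmx_mul trmxK !mulmxA.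
apply: eq_bigr => i _; rewrite mxE; apply: eq_bigr => j _.
move: (P^T *m U) (Q^T *m V) => M N.
by rewrite mul_mx_diag mul_diag_mx !mxE mulrACA mulrA; ring.
Qed.

Lemma card_ord_lt n k : (k <= n)%N -> #|[pred i : 'I_n | (i < k)%N]| = k.
Proof.
move=> le_kn; rewrite -sum1_card -(big_ord_widen n (fun=> 1%N)) //.
by rewrite sum1_card card_ord.
Qed.

(** Weights in [[0, 1]] of total at most [k] do best on the [k] largest
    entries: moving weight across a threshold [s] that separates these from the
    others can only increase the weighted sum. *)
Lemma weighted_sum_le_kyfan n k (x : 'cV[R]_n) (c : 'I_n -> R) : (k <= n)%N ->
    (forall i, 0 <= x i 0) ->
    (forall i j : 'I_n, (i <= j)%N -> x j 0 <= x i 0) ->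
    (forall j, 0 <= c j <= 1) -> \sum_j c j <= k%:R ->
  \sum_j x j 0 * c j <= kyfan k x.
Proof.
move=> le_kn x_ge0 x_dec c01 sum_c.
have [s [s_ge0 s_lo s_hi]] : exists s, [/\ 0 <= s,
    forall j : 'I_n, (j < k)%N -> s <= x j 0
    & forall j : 'I_n, (k <= j)%N -> x j 0 <= s].
  have [lt_kn|le_nk] := ltnP k n.
    exists (x (Ordinal lt_kn) 0); split=> // j ?; apply: x_dec => //.
    exact: ltnW.
  by exists 0; split=> // j; rewrite leqNgt (leq_trans (ltn_ord j)).
have le_j j : x j 0 * c j <= s * c j + (if (j < k)%N then x j 0 - s else 0).
  have /andP[c0 c1] := c01 j.
  have [/s_lo xs|/s_hi xs] := ltnP j k; nra.
apply: le_trans (ler_sum _ (fun j _ => le_j j)) _.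
rewrite big_split /= -big_mkcond sumrB -mulr_sumr /kyfan addrCA gerDl subr_le0.
by rewrite sumr_const card_ord_lt // -mulr_natr ler_wpM2l.
Qed.

(** With [X = U diag(sigma X) V^T], [M = P^T U] and [N = Q^T V], the bound
    [M_ij N_ij <= (M_ij^2 + N_ij^2) / 2] makes the inner product at most a
    weighted sum of singular values; Bessel's inequality for the rows and for
    the columns of [M] and [N] gives the two constraints on the weights. *)
Lemma mxdot_le_kyfan m n k (P : 'M[R]_(m, n)) Q X : (k <= n)%N -> (n <= m)%N ->
  orthonormal P -> orthonormal Q ->
  mxdot (svd_mx P (kyfan_vec n k) Q) X <= kyfan k (sigma X).
Proof.
move=> le_kn le_nm oP oQ; have [U [V [oU oV XE]]] := svd_sigma X le_nm.
rewrite [in X in X <= _]XE mxdot_svd.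
set M := P^T *m U; set N := Q^T *m V; set a := kyfan_vec n k.
have a01 i : 0 <= a i 0 <= 1 by rewrite mxE ler0n lern1 leq_b1.
pose c j := \sum_i a i 0 * ((M i j ^+ 2 + N i j ^+ 2) / 2).
apply: (@le_trans _ _ (\sum_j sigma X j 0 * c j)); last first.
  apply: weighted_sum_le_kyfan => //.
  - exact: sigma_ge0.
  - by move=> i j; apply: sigma_sorted.
  - move=> j; apply/andP; split.
      apply: sumr_ge0 => i _; have /andP[a0 _] := a01 i; nra.
    apply: (@le_trans _ _ (\sum_i ((M i j ^+ 2 + N i j ^+ 2) / 2))).
      apply: ler_sum => i _; have /andP[_ a1] := a01 i; nra.
    rewrite -mulr_suml big_split /=.
    have := bessel j oP oU; have := bessel j oQ oV; rewrite -/M -/N; lra.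
  - rewrite exchange_big /=; apply: (@le_trans _ _ (\sum_i a i 0)).
      apply: ler_sum => i _; rewrite -mulr_sumr -mulr_suml big_split /=.
      have := bessel_row i oP oU; have := bessel_row i oQ oV; rewrite -/M -/N.
      have /andP[a0 _] := a01 i; nra.
    under eq_bigr do rewrite mxE mulrb.
    by rewrite -big_mkcond /= sumr_const card_ord_lt.
rewrite exchange_big /=; apply: ler_sum => j _; rewrite mulr_sumr.
apply: ler_sum => i _; have /andP[a0 _] := a01 i.
rewrite [leRHS]mulrCA [leRHS]mulrA.
apply: ler_wpM2l; first by rewrite mulr_ge0 // sigma_ge0.
by have := sqr_ge0 (M i j - N i j); lra.
Qed.

Lemma svd_entry_le m n (U : 'M[R]_(m, n)) (y : 'cV[R]_n) V e i j :
  orthonormal U -> orthonormal V ->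
  (forall l, `|y l 0| <= e) -> `|svd_mx U y V i j| <= n%:R * e.
Proof.
move=> oU oV le_y; rewrite mxE (le_trans (ler_norm_sum _ _ _)) //.
rewrite mulr_natl -[n in X in _ <= X]card_ord -sumr_const.
apply: ler_sum => l _; rewrite mul_mx_diag !mxE !normrM; have := le_y l.
have := orthonormal_entry_le1 i l oU; have := orthonormal_entry_le1 j l oV.
have := normr_ge0 (U i l); have := normr_ge0 (V j l).
have := normr_ge0 (y l 0).
set a := `|U i l|; set b := `|V j l|; set c := `|y l 0| => c0 b0 a0 b1 a1 ce.
have ac : a * c <= c by rewrite ler_piMl.
by apply: le_trans ce; apply: le_trans ac; rewrite ler_piMr // mulr_ge0.
Qed.

(** [phi] is a pointwise maximum of linear functionals with coefficients
    bounded by [c]; convexity and Lipschitz continuity are read off from this. *)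
Definition has_supports m n (c : R) (phi : 'M[R]_(m, n) -> R) : Prop :=
  forall X, exists A : 'M[R]_(m, n),
    [/\ mxdot A X = phi X, forall Y, mxdot A Y <= phi Y
      & forall i j, `|A i j| <= c].

(** At [X = U diag(sigma X) V^T] the supporting functional is the matrix
    obtained by replacing the [k] largest singular values by 1 and the others
    by 0. *)
Lemma kyfan_support m n k : (k <= n)%N -> (n <= m)%N ->
  has_supports n%:R (fun X : 'M[R]_(m, n) => kyfan k (sigma X)).
Proof.
move=> le_kn le_nm X; have [U [V [oU oV XE]]] := svd_sigma X le_nm.
exists (svd_mx U (kyfan_vec n k) V); split.
- rewrite {1}XE mxdot_svd oU oV /kyfan [RHS]big_mkcond; apply: eq_bigr => i _.
  rewrite (bigD1 i) //= big1 => [|j /negPf ji]; last first.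
    by rewrite !mxE eq_sym ji !mulr0.
  by rewrite addr0 !mxE eqxx !mulr1; case: ifP => _; rewrite ?mul1r ?mul0r.
- by move=> Y; apply: mxdot_le_kyfan.
- move=> i j; rewrite -[n%:R]mulr1; apply: svd_entry_le => // l.
  by rewrite mxE normr_nat lern1 leq_b1.
Qed.

Lemma mxdotE m n (A X : 'M[R]_(m, n)) :
  mxdot A X = \sum_j \sum_i A i j * X i j.
Proof.
by apply: eq_bigr => j _; rewrite mxE; apply: eq_bigr => i _; rewrite mxE.
Qed.

Lemma mxdotDr m n (A X Y : 'M[R]_(m, n)) :
  mxdot A (X + Y) = mxdot A X + mxdot A Y.
Proof. by rewrite /mxdot mulmxDr raddfD. Qed.

Lemma mxdotZr m n (A X : 'M[R]_(m, n)) t : mxdot A (t *: X) = t * mxdot A X.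
Proof. by rewrite /mxdot -scalemxAr mxtraceZ. Qed.

Lemma mx_norm_le m n (A : 'M[R]_(m, n)) e : 0 <= e ->
  (forall i j, `|A i j| <= e) -> `|A| <= e.
Proof.
move=> e0 le_e.
by rewrite /Num.norm /= mx_normrE; apply/bigmax_leP; split=> // ij _.
Qed.

Lemma entry_le_norm m n (A : 'M[R]_(m, n)) i j : `|A i j| <= `|A|.
Proof.
by rewrite [leRHS]/Num.norm /= mx_normrE; apply: (le_bigmax _ _ (i, j)).
Qed.

Lemma mxdot_le m n c (A X : 'M[R]_(m, n)) : (forall i j, `|A i j| <= c) ->
  mxdot A X <= n%:R * m%:R * c * `|X|.
Proof.
move=> Ale; rewrite mxdotE.
apply: (@le_trans _ _ (\sum_(j < n) \sum_(i < m) c * `|X|)).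
  apply: ler_sum => j _; apply: ler_sum => i _.
  by rewrite (le_trans (ler_norm _)) // normrM ler_pM // entry_le_norm.
by rewrite !sumr_const !card_ord -[_ *+ m]mulr_natl -[_ *+ n]mulr_natl !mulrA.
Qed.

Lemma supports_lipschitz m n c (phi : 'M[R]_(m, n) -> R) X Y :
  has_supports c phi -> `|phi X - phi Y| <= n%:R * m%:R * c * `|X - Y|.
Proof.
move=> support.
suff le_sub Z W : phi Z - phi W <= n%:R * m%:R * c * `|Z - W|.
  by rewrite ler_norml lerNl opprB le_sub andbT distrC le_sub.
have [A [<- Ale Ab]] := support Z.
apply: le_trans (mxdot_le (Z - W) Ab).
by rewrite -[- W]scaleN1r mxdotDr mxdotZr mulN1r lerD2l lerN2 Ale.
Qed.

(** The difference quotients are nondecreasing in [t]: compare them through a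
    support at the intermediate point [X + s H]. They are bounded below by
    [<A, H>] for a support [A] at [X]. *)
Lemma supports_dir_cvg m n c (phi : 'M[R]_(m, n) -> R) X H :
    has_supports c phi ->
  cvg (t^-1 * (phi (X + t *: H) - phi X) @[t --> 0^'+]).
Proof.
move=> support; apply: nondecreasing_at_right_is_cvgr; near=> d.
  move=> s t; rewrite !in_itv /= => /andP[s0 _] /andP[t0 _] le_st.
  have [A [AX Ale _]] := support (X + s *: H).
  have := Ale X; have := Ale (X + t *: H).
  rewrite -AX !mxdotDr !mxdotZr => le_t le_0.
  rewrite ler_pdivrMl // mulrCA ler_pdivlMl //.
  nra.
have [A [AX Ale _]] := support X.
exists (mxdot A H) => q [t /=]; rewrite in_itv /= => /andP[t0 _] <-{q}.
by rewrite ler_pdivlMl // -AX lerBrDl -mxdotZr -mxdotDr Ale.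
Unshelve. all: by end_near.
Qed.

End KyFan.

(** * Differential properties of the singular values *)

Section SigmaDerivative.
Variable R : realType.

Lemma entry_kyfan n (x : 'cV[R]_n) (i : 'I_n) :
  x i 0 = kyfan i.+1 x - kyfan i x.
Proof.
rewrite /kyfan (bigD1 i) //= (eq_bigl (fun j : 'I_n => (j < i)%N)).
  by rewrite addrK.
by move=> j; rewrite ltnS andbC -ltn_neqAle.
Qed.

Lemma cvg_col n (T : Type) (F : set_system T) {FF : Filter F}
    (u : T -> 'cV[R]_n) (l : 'cV[R]_n) :
  (forall i, u x i 0 @[x --> F] --> l i 0) -> u @ F --> l.
Proof.
move=> u_cvg; apply/cvgrPdist_le => e e0.
have : \forall x \near F, forall i, `|l i 0 - u x i 0| <= e.
  by apply: filter_forall => i; have /cvgrPdist_le := u_cvg i; apply.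
apply: filterS => x le_e; apply: mx_norm_le => [|i j]; first exact: ltW.
by rewrite ord1 mxE [X in _ + X]mxE.
Qed.

Lemma sigma_dir_cvg m n (X H : 'M[R]_(m, n)) : (n <= m)%N ->
  t^-1 *: (sigma (X + t *: H) - sigma X) @[t --> 0^'+] --> sigma' X H.
Proof.
move=> le_nm; apply/cvg_ex.
pose dk k t := t^-1 * (kyfan k (sigma (X + t *: H)) - kyfan k (sigma X)).
have dk_cvg k (le_kn : (k <= n)%N) : cvg (dk k t @[t --> 0^'+]) :=
  supports_dir_cvg (X := X) (H := H) (kyfan_support le_kn le_nm).
pose l k := lim (dk k t @[t --> 0^'+]).
exists (\col_(i < n) (l i.+1 - l i)); apply: cvg_col => i; rewrite mxE.
rewrite (_ : (fun t => _) = (fun t => dk i.+1 t - dk i t)).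
  by apply: cvgB; apply: dk_cvg; rewrite // ltnW.
apply/funext => t; rewrite mxE [X in _ * X]mxE [X in _ + X]mxE /dk.
rewrite -mulrBr; congr (_ * _); move: (sigma (X + t *: H)) (sigma X) => x y.
by rewrite (entry_kyfan x) (entry_kyfan y); ring.
Qed.

Lemma entry_dist_kyfan n (x y : 'cV[R]_n) (i : 'I_n) :
  `|x i 0 - y i 0| <= `|kyfan i.+1 x - kyfan i.+1 y| + `|kyfan i x - kyfan i y|.
Proof.
have -> : x i 0 - y i 0 =
    (kyfan i.+1 x - kyfan i.+1 y) - (kyfan i x - kyfan i y).
  by rewrite (entry_kyfan x) (entry_kyfan y); ring.
exact: ler_normB.
Qed.

Lemma sigma_lipschitz m n : (n <= m)%N ->
  exists2 L : R, 0 <= L &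
    forall X Y : 'M[R]_(m, n), `|sigma X - sigma Y| <= L * `|X - Y|.
Proof.
move=> le_nm; pose L : R := n%:R * m%:R * n%:R.
have L0 : 0 <= L by rewrite !mulr_ge0.
exists (2 * L) => [|X Y]; first by rewrite mulr_ge0.
apply: mx_norm_le => [|i j]; first by rewrite !mulr_ge0.
rewrite ord1 mxE [X in _ + X]mxE; apply: le_trans (entry_dist_kyfan _ _ _) _.
rewrite -mulrA mulr_natl mulr2n.
have lip k (le_kn : (k <= n)%N) :=
  supports_lipschitz X Y (kyfan_support le_kn le_nm).
by apply: lerD; apply: lip; rewrite // ltnW.
Qed.

Definition sigma_quotient m n (X : 'M[R]_(m, n)) t (H : 'M[R]_(m, n)) :=
  t^-1 *: (sigma (X + t *: H) - sigma X).

Lemma sigma_quotientK m n (X : 'M[R]_(m, n)) t H : t != 0 ->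
  sigma X + t *: sigma_quotient X t H = sigma (X + t *: H).
Proof. by move=> t0; rewrite scalerA mulfV // scale1r addrC subrK. Qed.

Lemma sigma_quotient_near m n (X H : 'M[R]_(m, n)) e : (n <= m)%N -> 0 < e ->
  \forall t \near 0^'+, `|sigma' X H - sigma_quotient X t H| < e.
Proof.
move=> le_nm.
by have /cvgrPdist_lt := sigma_dir_cvg (X := X) (H := H) le_nm; apply.
Qed.

Lemma sigma_quotient_lipschitz m n (X : 'M[R]_(m, n)) : (n <= m)%N ->
  exists2 L, 0 <= L & forall t H H', 0 < t ->
    `|sigma_quotient X t H - sigma_quotient X t H'| <= L * `|H - H'|.
Proof.
move=> le_nm; have [L L0 lipL] := sigma_lipschitz le_nm.
exists L => // t H H' t0.
rewrite /sigma_quotient -scalerBr normrZ gtr0_norm ?invr_gt0 // ler_pdivrMl //.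
rewrite opprB addrA subrK; apply: le_trans (lipL _ _) _.
rewrite opprD addrACA subrr add0r -scalerBr normrZ gtr0_norm //.
by rewrite mulrCA.
Qed.

(** [X + t H'] keeps the orthonormal factors of [X + t H] and has
    [sigma X + t z] on the diagonal. *)
Lemma sigma_lift m n (X H : 'M[R]_(m, n)) t z : (n <= m)%N -> 0 < t ->
  exists H', `|H - H'| <= n%:R * `|z - sigma_quotient X t H| /\
    exists2 Q, signed_permutation Q
      & sigma (X + t *: H') = Q *m (sigma X + t *: z).
Proof.
move=> le_nm t0; have [U [V [oU oV XE]]] := svd_sigma (X + t *: H) le_nm.
exists (H + svd_mx U (z - sigma_quotient X t H) V); split.
  rewrite opprD addrA subrr add0r normrN; apply: mx_norm_le => [|i j].
    by rewrite mulr_ge0.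
  by apply: svd_entry_le => // l; apply: entry_le_norm.
have [s [e [sQ _ sE]]] := sigma_svd_signed_perm (sigma X + t *: z) oU oV.
exists (signed_perm_mx s e) => //; rewrite -sE; congr sigma.
rewrite scalerDr addrA XE -svd_mxZ -svd_mxD; congr svd_mx.
rewrite -(sigma_quotientK X H (lt0r_neq0 t0)) -addrA -scalerDr.
by rewrite [sigma_quotient X t H + _]addrC subrK.
Qed.

End SigmaDerivative.

(** * Comparison of subderivatives *)

Section Subderivative.
Variable R : realType.

Lemma limf_einf_le (T U : choiceType) (X : filteredType U) (Y : filteredType T)
    (h : X -> \bar R) (g : Y -> \bar R) G F :
    (forall A, G A ->
      exists2 B, F B & forall b, B b -> exists2 a, A a & (h a <= g b)%E) ->
  (limf_einf h G <= limf_einf g F)%E.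
Proof.
move=> GF; rewrite !limf_einfE; apply: ge_ereal_sup => _ [A GA <-].
have [B FB AB] := GF A GA; apply: (@le_trans _ _ (ereal_inf (g @` B))).
  apply: le_ereal_inf_tmp => _ [b Bb <-]; have [a Aa le_ab] := AB b Bb.
  by apply: le_trans le_ab; apply: ereal_inf_lbound; exists a.
by apply: ereal_sup_ubound; exists B.
Qed.

(** If every difference quotient of [g] at [x] in a direction near [w] is also
    one of [h] at [y], with the same step and a direction near [z], then the
    lower limit for [h] is taken over at least as many values. *)
Lemma subderivative_le (V W : normedModType R) (g : V -> \bar R)
    (h : W -> \bar R) (x w : V) (y z : W) :
    g x = h y ->
    (forall e, 0 < e -> exists2 d, 0 < d & \forall t \near 0^'+,
      forall w', `|w - w'| < d ->
        exists2 z', `|z - z'| < e & h (y + t *: z') = g (x + t *: w')) ->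
  (subderivative h y z <= subderivative g x w)%E.
Proof.
move=> gh approx; apply: limf_einf_le => A [[A1 A2] /= [A1_0 A2_z] A12].
have /nbhs_normP[e /= e0 eA2] := A2_z.
have [d d0 near_t] := approx e e0.
pose B1 : set R := [set t | A1 t /\ forall w', `|w - w'| < d ->
  exists2 z', `|z - z'| < e & h (y + t *: z') = g (x + t *: w')].
pose B2 : set V := [set w' | `|w - w'| < d].
exists (B1 `*` B2).
  exists (B1, B2) => //; split => /=; first exact: filterI.
  by apply/nbhs_normP; exists d.
move=> [t w'] /= [[A1t near_w] ww']; have [z' zz' ghE] := near_w _ ww'.
exists (t, z'); first by apply: A12; split => //=; apply: eA2.
by rewrite /= ghE gh.
Qed.

Lemma subderivative_sigma_ge m n (X H : 'M[R]_(m, n)) (f : 'cV[R]_n -> \bar R) :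
    (n <= m)%N ->
  (subderivative f (sigma X) (sigma' X H)
   <= subderivative (f \o @sigma R m n) X H)%E.
Proof.
move=> le_nm; apply: subderivative_le => // e e0.
have [L L0 lipL] := sigma_quotient_lipschitz X le_nm.
exists (e / 2 / (L + 1)); first by rewrite !divr_gt0 // ltr_wpDl.
near=> t => H' HH'.
have t0 : 0 < t by near: t; exact: nbhs_right_gt.
exists (sigma_quotient X t H'); last by rewrite sigma_quotientK ?gt_eqF.
have qe : `|sigma' X H - sigma_quotient X t H| < e / 2.
  by near: t; apply: sigma_quotient_near => //; rewrite divr_gt0.
apply: (le_lt_trans (ler_distD (sigma_quotient X t H) _ _)).
rewrite (splitr e); apply: ltr_leD; first exact: qe.
apply: le_trans (lipL _ _ _ t0) _.
move: HH'; rewrite ltr_pdivlMr ?ltr_wpDl // => /ltW; apply: le_trans.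
by rewrite mulrC ler_wpM2l // lerDl.
Unshelve. all: by end_near.
Qed.

Lemma subderivative_sigma_le m n (X H : 'M[R]_(m, n)) (f : 'cV[R]_n -> \bar R) :
    (n <= m)%N -> absolutely_symmetric f ->
  (subderivative (f \o @sigma R m n) X H
   <= subderivative f (sigma X) (sigma' X H))%E.
Proof.
move=> le_nm f_sym; apply: subderivative_le => // e e0.
(* [z] and the quotient are both within [d] of [sigma' X H], and the lift
   magnifies their distance by at most [n] *)
pose d := e / (2 * (n%:R + 1)).
have n1 : 0 < n%:R + 1 :> R by rewrite ltr_wpDl.
have d0 : 0 < d by rewrite divr_gt0 // mulr_gt0.
exists d => //; near=> t => z zd.
have t0 : 0 < t by near: t; exact: nbhs_right_gt.
have qd : `|sigma' X H - sigma_quotient X t H| < d.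
  by near: t; apply: sigma_quotient_near.
have [H' [HH' [Q sQ sE]]] := sigma_lift X H z le_nm t0.
exists H'; last by rewrite /= sE f_sym.
apply: le_lt_trans HH' _.
have zq : `|z - sigma_quotient X t H| < d + d.
  apply: (le_lt_trans (ler_distD (sigma' X H) _ _)).
  by rewrite ltrD // distrC.
have -> : e = (n%:R + 1) * (d + d) by rewrite /d; field; rewrite gt_eqF.
apply: (@le_lt_trans _ _ ((n%:R + 1) * `|z - sigma_quotient X t H|)).
  by rewrite ler_wpM2r // lerDl.
by rewrite ltr_pM2l.
Unshelve. all: by end_near.
Qed.

End Subderivative.

Theorem theorem4p3 (R : realType) (m n : nat) (hnm : (n <= m)%N)
    (f : 'cV[R]_n -> \bar R) (X : 'M[R]_(m, n))
    (f_sym : absolutely_symmetric f)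
    (fX_fin : (f \o @sigma R m n) X \is a fin_num)
    (hf : [/\ lower_semicontinuous f, convex_efun f
            & subdifferential f (sigma X) !=set0]
          \/ locally_lipschitz_rel f (sigma X) (edom f)) :
  forall H : 'M[R]_(m, n),
    subderivative (f \o @sigma R m n) X H
    = subderivative f (sigma X) (sigma' X H).
Proof.
move=> H; apply/eqP; rewrite eq_le.
by rewrite subderivative_sigma_le ?subderivative_sigma_ge.
Qed.
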